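(* Let $n,r\in\mathbb{N}$ with $r\geq 2$, let $E$ be a nontrivial uniformly complete Archimedean real vector lattice, and let $Y$ be a real separated convex bornological space. Suppose $P\colon E\to Y$ is a bounded $n$-homogeneous polynomial. Then the following are equivalent. (i) $P$ is orthogonally additive. (ii) $\sum_{k=1}^{r}P(f_k)=\sum_{k=1}^{r}P\bigl(\mathcal{M}_k(f_1,\dots,f_r)\bigr)$ holds for every $f_1,\dots,f_r\in E$. (iii) $\sum_{k=1}^{r}P(f_k)=\sum_{k=1}^{r}P\bigl(\mathcal{M}_k(f_1,\dots,f_r)\bigr)$ holds for every $f_1,\dots,f_r\in E^+$.
   Context: $\mathbb{N}$ is the set of strictly positive integers and $[r]:=\{1,\dots,r\}$; nontrivial means $E\neq\{0\}$; $E^+$ is the positive cone of $E$. Uniformly complete means relatively uniformly complete: for every $u\in E^+$, every $u$-uniformly Cauchy sequence converges $u$-uniformly in $E$. A real convex bornological space is a real vector space $Y$ with a family of subsets (called bounded) that covers $Y$ and is closed under passing to subsets, finite unions, vector sums, multiplication by scalars, balanced hulls and convex hulls; it is separated if $\{0\}$ is the only bounded vector subspace. The vector lattice $E$ carries the bornology of order bounded sets, and a map $E\to Y$ is bounded if it maps order bounded subsets of $E$ to bounded subsets of $Y$. An $n$-homogeneous polynomial $P\colon E\to Y$ is a map of the form $P(f)=\varphi(f,\dots,f)$ for some $n$-linear map $\varphi\colon E^n\to Y$. It is orthogonally additive if $P(f+g)=P(f)+P(g)$ for all $f,g\in E$ with $|f|\wedge|g|=0$. For $f_1,\dots,f_r\in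 E$ and $k\in[r]$, $$\mathcal{M}_k(f_1,\dots,f_r)=\bigvee_{\substack{i_1,\dots,i_{r+1-k}\in[r]\\ i_1<i_2<\cdots<i_{r+1-k}}}\ \bigwedge_{j=1}^{r+1-k}f_{i_j}.$$ *)

(* Defs.v *)
From HB Require Import structures.
From mathcomp Require Import all_boot all_order all_algebra.
From mathcomp Require Import all_classical all_reals convex.

Set Implicit Arguments.
Unset Strict Implicit.
Unset Printing Implicit Defensive.

Import Order.TTheory GRing.Theory Num.Theory.

Local Open Scope classical_set_scope.
Local Open Scope ring_scope.

(* Inheriting from [Order.Lattice] directly is rejected (missing join with
   [Num.RealDomain]); the lattice structure is therefore recovered below as an
   instance on every vector lattice. *)
HB.mixin Record isVectorLattice (R : numDomainType) (E : Type)
    of Num.POrderedZmodule E & GRing.Lmodule R E := {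
  vlat_meet : E -> E -> E;
  vlat_join : E -> E -> E;
  vlat_lexI : forall x y z : E, (x <= vlat_meet y z) = (x <= y) && (x <= z);
  vlat_leUx : forall x y z : E, (vlat_join x y <= z) = (x <= z) && (y <= z);
  vlat_leD2r : forall z x y : E, x <= y -> x + z <= y + z;
  vlat_scaler_ge0 : forall (a : R) (x : E), 0 <= a -> 0 <= x -> 0 <= a *: x
}.

#[short(type="vectorLatticeType")]
HB.structure Definition VectorLattice (R : numDomainType) :=
  { E of Num.POrderedZmodule E & GRing.Lmodule R E & isVectorLattice R E }.

#[non_forgetful_inheritance]
HB.instance Definition _ (R : numDomainType) (E : vectorLatticeType R) :=
  Order.POrder_isMeetSemilattice.Build ring_display (VectorLattice.sort E)
    (@vlat_lexI R E).

#[non_forgetful_inheritance]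
HB.instance Definition _ (R : numDomainType) (E : vectorLatticeType R) :=
  Order.POrder_isJoinSemilattice.Build ring_display (VectorLattice.sort E)
    (@vlat_leUx R E).

Section VectorLatticeDefs.
Context {R : realType} {E : vectorLatticeType R}.
Implicit Types (f g u v x : E) (A : set E).

Definition vabs f : E := Order.join f (- f).

Definition nontrivial : Prop := exists x, x != 0.

Definition archimedean : Prop :=
  forall u v, 0 <= u -> 0 <= v -> (forall m : nat, u *+ m <= v) -> u = 0.

Definition uniformly_cauchy u (s : nat -> E) : Prop :=
  forall e : R, 0 < e ->
  exists N : nat, forall p q : nat, (N <= p)%N -> (N <= q)%N ->
    vabs (s p - s q) <= e *: u.

Definition uniformly_converges u (s : nat -> E) x : Prop :=
  forall e : R, 0 < e ->
  exists N : nat, forall p : nat, (N <= p)%N -> vabs (s p - x) <= e *: u.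

Definition uniformly_complete : Prop :=
  forall u, 0 <= u ->
  forall s : nat -> E, uniformly_cauchy u s ->
  exists x, uniformly_converges u s x.

Definition order_bounded A : Prop := exists a b : E, A `<=` `[a, b].

(* Without top and bottom elements only nonempty finite families have a join and
   a meet; the value 0 on the empty list is a dummy. *)
Definition fin_join (s : seq E) : E :=
  if s is x :: s' then \big[Order.join/x]_(y <- s') y else 0.

Definition fin_meet (s : seq E) : E :=
  if s is x :: s' then \big[Order.meet/x]_(y <- s') y else 0.

(* [M_ k f] is meant for 1 <= k <= r: the index tuples are then nonempty and
   at least one of them is increasing. *)
Definition M_ (r k : nat) (f : 'I_r -> E) : E :=
  fin_join [seq fin_meet [seq f j | j <- t]
           | t : (r.+1 - k).-tuple 'I_r <- enum {: (r.+1 - k).-tuple 'I_r}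
           & sorted ltn [seq val j | j <- t]].

End VectorLatticeDefs.

Arguments nontrivial {R} E.
Arguments archimedean {R} E.
Arguments uniformly_complete {R} E.

Section Hulls.
Context {R : numDomainType} {Y : lmodType R}.
Implicit Type B : set Y.

Definition balanced B : Prop :=
  forall (c : R) (y : Y), `|c| <= 1 -> B y -> B (c *: y).

Definition balanced_hull B : set Y := smallest balanced B.

Definition convex_hull B : set Y := smallest (@convex_set R Y) B.

End Hulls.

HB.mixin Record isConvexBornological (R : numDomainType) (Y : Type)
    of GRing.Lmodule R Y := {
  bornology : set (set Y);
  bornology_cover : \bigcup_(B in bornology) B = setT;
  bornologyS : forall A B, A `<=` B -> bornology B -> bornology A;
  bornologyU : forall A B, bornology A -> bornology B -> bornology (A `|` B);
  bornologyD : forall A B, bornology A -> bornology B ->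
    bornology [set x + y | x in A & y in B];
  bornologyZ : forall (c : R) B, bornology B -> bornology [set c *: y | y in B];
  bornology_balanced_hull : forall B, bornology B -> bornology (balanced_hull B);
  bornology_convex_hull : forall B, bornology B -> bornology (convex_hull B)
}.

#[short(type="convexBornologicalType")]
HB.structure Definition ConvexBornological (R : numDomainType) :=
  { Y of GRing.Lmodule R Y & isConvexBornological R Y }.

Definition separated {R : realType} (Y : convexBornologicalType R) : Prop :=
  forall V : set Y, submod_closed [in V] -> bornology V -> V = [set 0].

Section Polynomials.
Context {R : realType}.

Definition multilinear (n : nat) (E Y : lmodType R) (phi : ('I_n -> E) -> Y) :
    Prop :=
  forall (v : 'I_n -> E) (i : 'I_n),
    linear (fun x : E => phi (@dfwith _ (fun=> E) v i x)).

Definition homogeneous_polynomial (n : nat) (E Y : lmodType R) (P : E -> Y) :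
    Prop :=
  exists2 phi : ('I_n -> E) -> Y, multilinear phi & forall f, P f = phi (fun=> f).

Definition bounded_map (E : vectorLatticeType R) (Y : convexBornologicalType R)
    (P : E -> Y) : Prop :=
  forall A : set E, order_bounded A -> bornology (P @` A).

Definition orthogonally_additive (E : vectorLatticeType R) (Y : lmodType R)
    (P : E -> Y) : Prop :=
  forall f g : E, Order.meet (vabs f) (vabs g) = 0 -> P (f + g) = P f + P g.

End Polynomials.

(* Main.v *)
(* Orthogonal additivity is equivalent to the valuation identity
   [P (x ∨ y) + P (x ∧ y) = P x + P y].  This goes by induction on the degree: if
   [P] is bounded and additive on disjoint pairs [u, v >= 0], so is each
   directional derivative [D_b P], because it is linear in [b] and, up to an error
   controlled by boundedness, [b] splits into a part disjoint from [v] and a part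
   disjoint from [u].  Hence [D_b P] is a valuation, and integrating along
   [b = x ∧ y] gives the identity for [P].  Derivatives along lines are finite
   linear combinations of values of [P], hence bounded with [P].  The
   [M_k (f_1, ..., f_r)] arise from the [f_i] by repeatedly replacing a pair by its
   join and meet, so a valuation has the same sum over both families. *)
Require Import Defs.
From mathcomp Require Import all_boot all_order all_algebra.
From mathcomp Require Import all_classical all_reals.

Set Implicit Arguments.
Unset Strict Implicit.
Unset Printing Implicit Defensive.

Import Order.TTheory GRing.Theory Num.Theory.

Local Open Scope classical_set_scope.
Local Open Scope ring_scope.

(** * Vector lattice identities and disjointness *)

Section VectorLatticeTheory.
Context {R : realType} {E : vectorLatticeType R}.
Implicit Types (a b c f g u v x y z : E) (t : R).

Local Notation "x ∨ y" := (Order.join (x : E) (y : E)) (at level 50, left associativity).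
Local Notation "x ∧ y" := (Order.meet (x : E) (y : E)) (at level 48, left associativity).

Lemma vlat_leD2rE z x y : (x + z <= y + z) = (x <= y).
Proof.
apply/idP/idP => [/(vlat_leD2r (- z))|]; last exact: vlat_leD2r.
by rewrite !addrK.
Qed.

Lemma vlat_leD a b x y : a <= b -> x <= y -> a + x <= b + y.
Proof.
move=> ab xy; apply: (@le_trans _ _ (b + x)); first by rewrite vlat_leD2rE.
by rewrite ![b + _]addrC vlat_leD2rE.
Qed.

Lemma vlat_le_subl x y z : (x - y <= z) = (x <= z + y).
Proof. by rewrite -[LHS](vlat_leD2rE y) subrK. Qed.

Lemma vlat_le_subr x y z : (x <= y - z) = (x + z <= y).
Proof. by rewrite -[LHS](vlat_leD2rE z) subrK. Qed.

Lemma vlat_subr_ge0 x y : (0 <= x - y) = (y <= x).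
Proof. by rewrite vlat_le_subr add0r. Qed.

Lemma vlat_leN2 x y : (- x <= - y) = (y <= x).
Proof. by rewrite -[LHS]vlat_subr_ge0 opprK addrC vlat_subr_ge0. Qed.

Lemma vlat_oppr_ge0 x : (0 <= - x) = (x <= 0).
Proof. by rewrite -[RHS]vlat_leN2 oppr0. Qed.

Lemma vlat_le_oppr x y : (x <= - y) = (y <= - x).
Proof. by rewrite -[LHS]vlat_leN2 opprK. Qed.

Lemma vlat_addr_ge0 x y : 0 <= x -> 0 <= y -> 0 <= x + y.
Proof. by move=> x0 y0; rewrite -[0]addr0 vlat_leD. Qed.

Lemma vlat_ler_wpZ t x y : 0 <= t -> x <= y -> t *: x <= t *: y.
Proof.
move=> t0; rewrite -vlat_subr_ge0 => /(vlat_scaler_ge0 _ _ t0).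
by rewrite scalerBr vlat_subr_ge0.
Qed.

Lemma vlat_ler_pZ t x y : 0 < t -> (t *: x <= t *: y) = (x <= y).
Proof.
move=> t0; apply/idP/idP; last by apply: vlat_ler_wpZ; rewrite ltW.
have tV : 0 <= t^-1 by rewrite invr_ge0 ltW.
by move/(vlat_ler_wpZ tV); rewrite !scalerA mulVf ?gt_eqF// !scale1r.
Qed.

Lemma vlat_joinDr x y z : (x ∨ y) + z = (x + z) ∨ (y + z).
Proof.
apply/le_anti/andP; split; last by rewrite leUx !vlat_leD2rE leUl leUr.
by rewrite -[X in _ <= X](subrK z) vlat_leD2rE leUx !vlat_le_subr leUl leUr.
Qed.

Lemma vlat_meetDr x y z : (x ∧ y) + z = (x + z) ∧ (y + z).
Proof.
apply/le_anti/andP; split; first by rewrite lexI !vlat_leD2rE leIl leIr.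
by rewrite -[X in X <= _](subrK z) vlat_leD2rE lexI !vlat_le_subl leIl leIr.
Qed.

Lemma vlat_oppU x y : - (x ∨ y) = (- x) ∧ (- y).
Proof.
apply/le_anti/andP; split; first by rewrite lexI !vlat_leN2 leUl leUr.
by rewrite vlat_le_oppr leUx (vlat_le_oppr x) (vlat_le_oppr y) leIl leIr.
Qed.

Lemma vlat_oppI x y : - (x ∧ y) = (- x) ∨ (- y).
Proof. by apply: oppr_inj; rewrite vlat_oppU !opprK. Qed.

Lemma vlat_subI x y : x - (x ∧ y) = (x - y) ∨ 0.
Proof. by rewrite vlat_oppI addrC vlat_joinDr addNr addrC joinC. Qed.

Lemma vlat_meetZ t x y : 0 < t -> t *: (x ∧ y) = (t *: x) ∧ (t *: y).
Proof.
move=> t0; have tn0 : t != 0 by rewrite gt_eqF.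
apply/le_anti/andP; split; first by rewrite lexI !vlat_ler_pZ// leIl leIr.
have tV z w : (t^-1 *: z <= w) = (z <= t *: w).
  by rewrite -[LHS](vlat_ler_pZ _ _ t0) scalerA mulfV// scale1r.
by rewrite -tV lexI !tV leIl leIr.
Qed.

Lemma vlat_joinDmeet x y : (x ∨ y) + (x ∧ y) = x + y.
Proof.
rewrite -[x ∧ y]opprK -[x ∧ y in LHS](opprK).
rewrite vlat_oppI.
have -> : x ∨ y = ((- y) ∨ (- x)) + (x + y).
  by rewrite vlat_joinDr [x + y]addrC addKr [y + x]addrC addKr.
by rewrite opprK joinC addrAC subrr add0r.
Qed.

Lemma join_disjoint x y : x ∧ y = 0 -> x ∨ y = x + y.
Proof. by move=> xy; rewrite -vlat_joinDmeet xy addr0. Qed.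

(** For [e = x] and [e = y], the identity [e = (z ∨ e) + (z ∧ e) - z] bounds [e] by
    [w + (z ∨ (x ∨ y)) - z]. Hence [x ∨ y] has the same bound, and the same identity for [x ∨ y]
    turns it into the claim. *)
Lemma vlat_meetUr z x y : z ∧ (x ∨ y) = (z ∧ x) ∨ (z ∧ y).
Proof.
apply/le_anti/andP; split; last by rewrite leUx !leI2 ?leUl ?leUr.
set w := (z ∧ x) ∨ (z ∧ y).
have ub e : e <= x ∨ y -> z ∧ e <= w -> e <= w + (z ∨ (x ∨ y)) - z.
  move=> exy zew; rewrite vlat_le_subr (addrC e) -(vlat_joinDmeet z) addrC.
  by apply: vlat_leD => //; rewrite leU2.
have : x ∨ y <= w + (z ∨ (x ∨ y)) - z by rewrite leUx !ub ?leUl ?leUr.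
by rewrite vlat_le_subr (addrC _ z) -(vlat_joinDmeet z) addrC vlat_leD2rE.
Qed.

Lemma vlat_meetUl z x y : (x ∨ y) ∧ z = (x ∧ z) ∨ (y ∧ z).
Proof. by rewrite ![_ ∧ z]meetC vlat_meetUr. Qed.

Lemma disjoint_le x y u v :
  0 <= u -> 0 <= v -> u <= x -> v <= y -> x ∧ y = 0 -> u ∧ v = 0.
Proof.
move=> u0 v0 ux vy xy0; apply/le_anti; rewrite lexI u0 v0 !andbT -xy0.
exact: leI2.
Qed.

Lemma disjoint_addl x y z :
  0 <= x -> 0 <= y -> 0 <= z -> x ∧ z = 0 -> y ∧ z = 0 -> (x + y) ∧ z = 0.
Proof.
move=> x0 y0 z0 xz yz.
have xy0 : 0 <= x + y by apply: vlat_addr_ge0.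
(* Enlarge [z] to [z + y]; by translation the meet becomes [(x ∧ z) + y = y]. *)
have le_y : (x + y) ∧ z <= y.
  rewrite -[leRHS]add0r -xz vlat_meetDr leI2//.
  by rewrite -[leLHS]addr0 vlat_leD.
apply/le_anti; rewrite [X in _ && X]lexI xy0 z0 !andbT -[leRHS]yz lexI le_y.
exact: leIr.
Qed.

(** For [t <= 1] compare with [x ∧ y], for larger [t] with [(t *: x) ∧ (t *: y)], a multiple of
    [x ∧ y]. *)
Lemma disjointZ t x y :
  0 <= t -> 0 <= x -> 0 <= y -> x ∧ y = 0 -> (t *: x) ∧ y = 0.
Proof.
move=> t0 x0 y0 xy.
have [t1|/ltW t1] := leP t 1.
  apply: (disjoint_le _ y0 _ _ xy) => //; first exact: vlat_scaler_ge0.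
  rewrite -vlat_subr_ge0 -[X in X - _]scale1r -scalerBl vlat_scaler_ge0//.
  by rewrite subr_ge0.
have tp : 0 < t by apply: lt_le_trans t1.
apply: (@disjoint_le (t *: x) (t *: y)) => //; first exact: vlat_scaler_ge0.
  rewrite -vlat_subr_ge0 -[X in _ - X]scale1r -scalerBl vlat_scaler_ge0//.
  by rewrite subr_ge0.
by rewrite -vlat_meetZ// xy scaler0.
Qed.

Lemma joinDopp x : x = (x ∨ 0) - ((- x) ∨ 0).
Proof.
have -> : x ∨ 0 = ((- x) ∨ 0) + x.
  by rewrite vlat_joinDr addNr add0r joinC.
by rewrite addrAC subrr add0r.
Qed.

Lemma disjoint_pos_neg x : (x ∨ 0) ∧ ((- x) ∨ 0) = 0.
Proof.
have -> : (- x) ∨ 0 = - x + (x ∨ 0).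
  by rewrite [RHS]addrC vlat_joinDr subrr add0r joinC.
rewrite -[X in X ∧ _]add0r -vlat_meetDr.
have -> : 0 ∧ (- x) = - (x ∨ 0) by rewrite vlat_oppU oppr0 meetC.
by rewrite addNr.
Qed.

Lemma vabs_ge0 x : 0 <= vabs x.
Proof.
rewrite -(@vlat_ler_pZ 2) ?ltr0n// scaler0 scaler_nat mulr2n -(subrr x).
by apply: vlat_leD; rewrite ?leUl ?leUr.
Qed.

Lemma vabs_ge0_id x : 0 <= x -> vabs x = x.
Proof.
move=> x0; apply: join_l; apply: (@le_trans _ _ 0) => //.
by rewrite -vlat_oppr_ge0 opprK.
Qed.

Lemma pos_part_disjoint_sub x y : x ∧ y = 0 -> (x - y) ∨ 0 = x.
Proof.
move=> xy.
have -> : (x - y) ∨ 0 = (x ∨ y) - y by rewrite vlat_joinDr subrr.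
by rewrite -[x ∨ y]addr0 -xy vlat_joinDmeet addrK.
Qed.

(* [x ∨ y] and [- (x ∧ y)] are disjoint with difference [x + y], so they are its
   positive and negative parts. *)
Lemma join_abs_disjoint x y : vabs x ∧ vabs y = 0 ->
  x ∨ y = (x + y) ∨ 0 /\ x ∧ y = (x + y) ∧ 0.
Proof.
move=> xy.
have le0 z w : z <= vabs x -> w <= vabs y -> z ∧ w <= 0.
  by move=> zx wy; rewrite -xy leI2.
have absl z : z <= vabs z by rewrite leUl.
have absr z : - z <= vabs z by rewrite leUr.
have n0 : 0 <= - (x ∧ y) by rewrite vlat_oppr_ge0 le0.
have p0 : 0 <= x ∨ y.
  by rewrite -[x ∨ y]opprK vlat_oppU vlat_oppr_ge0 le0.
have self z : z ∧ (- z) <= 0.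
  by rewrite -vlat_oppr_ge0 -[z in z ∧ _]opprK -vlat_oppU opprK joinC vabs_ge0.
have pn : (x ∨ y) ∧ - (x ∧ y) = 0.
  (* Distributivity leaves four meets: [x ∧ - x] and [y ∧ - y] are nonpositive, and the mixed ones
     lie below [vabs x ∧ vabs y]. *)
  apply/le_anti; rewrite lexI p0 n0 !andbT vlat_oppI vlat_meetUl !vlat_meetUr !leUx.
  by rewrite !self (le0 x (- y))// (meetC y) (le0 (- x) y).
have e : x + y = (x ∨ y) - - (x ∧ y) by rewrite opprK vlat_joinDmeet.
have join_e : x ∨ y = (x + y) ∨ 0 by rewrite e pos_part_disjoint_sub.
split=> //; apply: (addrI (x ∨ y)).
by rewrite vlat_joinDmeet [in RHS]join_e vlat_joinDmeet addr0.
Qed.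

End VectorLatticeTheory.

(** * Interpolation of vector-valued polynomials *)

(* The coefficients of a polynomial [q] of degree at most [N] are fixed linear
   combinations of the values [q 0, ..., q N]; the weights are the entries of the
   inverse Vandermonde matrix. *)
Section Interpolation.
Context {R : realType} (N : nat).

Definition nodes : 'M[R]_N.+1 :=
  Vandermonde N.+1 (\row_(j < N.+1) (j : nat)%:R).

Lemma nodes_unitmx : nodes \in unitmx.
Proof.
rewrite unitmxE det_Vandermonde unitfE; apply/prodf_neq0 => i _.
apply/prodf_neq0 => j ij; rewrite !mxE subr_eq0 eqr_nat.
by rewrite gtn_eqF.
Qed.

Section Coefficients.
Context {Y : lmodType R}.
Implicit Types (q : R -> Y) (i : 'I_N.+1).

Definition interp_coef i q : Y :=
  \sum_(j < N.+1) invmx nodes j i *: q (j : nat)%:R.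

(** Encodes that [q] is a [Y]-valued polynomial of degree at most [N]. *)
Definition interpolated q : Prop :=
  forall t, q t = \sum_(i < N.+1) t ^+ i *: interp_coef i q.

Lemma eq_interp_coef i q1 q2 : q1 =1 q2 -> interp_coef i q1 = interp_coef i q2.
Proof. by move=> e; apply: eq_bigr => j _; rewrite e. Qed.

(** The nodes are nonnegative, so this form suits identities that hold only for nonnegative
    multiples of a positive element. *)
Lemma eq_nodes_interp_coef i q1 q2 :
  (forall j : 'I_N.+1, q1 (j : nat)%:R = q2 (j : nat)%:R) ->
  interp_coef i q1 = interp_coef i q2.
Proof. by move=> e; apply: eq_bigr => j _; rewrite e. Qed.

Lemma interp_coefP i a q1 q2 :
  interp_coef i (fun t => a *: q1 t + q2 t) =
  a *: interp_coef i q1 + interp_coef i q2.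
Proof.
rewrite scaler_sumr -big_split; apply: eq_bigr => j _ /=.
by rewrite scalerDr !scalerA mulrC.
Qed.

Lemma interp_coefD i q1 q2 :
  interp_coef i (fun t => q1 t + q2 t) = interp_coef i q1 + interp_coef i q2.
Proof.
rewrite -[interp_coef i q1]scale1r -interp_coefP.
by apply: eq_interp_coef => t; rewrite scale1r.
Qed.

Lemma interp_coefB i q1 q2 :
  interp_coef i (fun t => q1 t - q2 t) = interp_coef i q1 - interp_coef i q2.
Proof.
rewrite -scaleN1r addrC -interp_coefP.
by apply: eq_interp_coef => t; rewrite scaleN1r addrC.
Qed.

Lemma interp_coef0 i : interp_coef i (fun=> 0) = 0.
Proof. by apply: big1 => j _; rewrite scaler0. Qed.

Lemma interp_coef_sum i (I : Type) (r : seq I) (q : I -> R -> Y) :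
  interp_coef i (fun t => \sum_(k <- r) q k t) =
  \sum_(k <- r) interp_coef i (q k).
Proof.
elim: r => [|k r IH].
  by rewrite big_nil -[RHS](interp_coef0 i); apply: eq_interp_coef => t; rewrite big_nil.
rewrite big_cons -IH -interp_coefD.
by apply: eq_interp_coef => t; rewrite big_cons.
Qed.

Lemma interp_coef_monomial i k c : (k <= N)%N ->
  interp_coef i (fun t => t ^+ k *: c) = if i == k :> nat then c else 0.
Proof.
move=> kN; pose k' : 'I_N.+1 := inord k.
have k'E : k' = k :> nat by rewrite inordK.
(* Row [k] of the Vandermonde matrix holds the [k]-th powers of the nodes, so the weights for
   [t ^+ k] sum to an entry of the identity matrix. *)
have /matrixP/(_ k' i) := mulmxV nodes_unitmx.
rewrite !mxE => H.
transitivity ((\sum_j nodes k' j * invmx nodes j i) *: c).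
  rewrite scaler_suml; apply: eq_bigr => j _.
  by rewrite scalerA mulrC !mxE k'E.
by rewrite H eq_sym -val_eqE /= k'E; case: eqP; rewrite ?scale1r ?scale0r.
Qed.

Lemma interpolatedP a q1 q2 : interpolated q1 -> interpolated q2 ->
  interpolated (fun t => a *: q1 t + q2 t).
Proof.
move=> i1 i2 t; rewrite {1}i1 {1}i2 scaler_sumr -big_split.
by apply: eq_bigr => i _; rewrite interp_coefP scalerDr !scalerA mulrC.
Qed.

Lemma eq_interpolated q1 q2 : q1 =1 q2 -> interpolated q1 -> interpolated q2.
Proof.
move=> e i1 t; rewrite -e i1.
by apply: eq_bigr => i _; rewrite (eq_interp_coef _ e).
Qed.

Lemma interpolatedD q1 q2 : interpolated q1 -> interpolated q2 ->
  interpolated (fun t => q1 t + q2 t).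
Proof.
move=> i1 i2; have := interpolatedP 1 i1 i2.
by apply: eq_interpolated => t; rewrite scale1r.
Qed.

Lemma interpolatedB q1 q2 : interpolated q1 -> interpolated q2 ->
  interpolated (fun t => q1 t - q2 t).
Proof.
move=> i1 i2; have := interpolatedP (-1) i2 i1.
by apply: eq_interpolated => t; rewrite scaleN1r addrC.
Qed.

Lemma interpolated_monomial k c : (k <= N)%N ->
  interpolated (fun t => t ^+ k *: c).
Proof.
move=> kN t; rewrite (bigD1 (inord k)) //= interp_coef_monomial// inordK// eqxx.
rewrite big1 ?addr0// => i; rewrite -val_eqE /= inordK// => /negPf ik.
by rewrite interp_coef_monomial// ik scaler0.
Qed.

Lemma interpolated_at0 q : interpolated q -> interp_coef ord0 q = q 0.
Proof.
move=> ->; rewrite big_ord_recl expr0 scale1r big1 ?addr0// => i _.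
by rewrite expr0n scale0r.
Qed.

(* [interp_coef (inord 1)] of [t |-> q (s + t)] is the derivative of [q] at [s]. *)
Lemma interpolated_derive0 q : (0 < N)%N -> interpolated q ->
  (forall s, interp_coef (inord 1) (fun t => q (s + t)) = 0) -> q 1 = q 0.
Proof.
move=> N0 iq dq0.
pose c i := interp_coef i q.
(* The formal derivative: in the binomial expansion of [q (s + t)] only the terms linear in [t]
   contribute. *)
have dq s : \sum_(i < N.+1) (s ^+ i.-1 *+ i) *: c i = 0.
  rewrite -[RHS](dq0 s).
  rewrite (eq_interp_coef _ (fun t => iq (s + t))) interp_coef_sum.
  apply: eq_bigr => i _.
  under eq_interp_coef => t do rewrite exprDn scaler_suml.
  rewrite interp_coef_sum.
  have term (l : 'I_i.+1) :
      interp_coef (inord 1) (fun t => (s ^+ (i - l) * t ^+ l *+ 'C(i, l)) *: c i) =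
      if l == 1 :> nat then (s ^+ (i - l) *+ 'C(i, l)) *: c i else 0.
    rewrite [l == 1 :> nat]eq_sym -[X in X == _](@inordK N 1)//.
    rewrite -interp_coef_monomial; last by rewrite -ltnS (leq_trans (ltn_ord l)).
    by apply: eq_interp_coef => t; rewrite scalerA mulrnAr [in RHS]mulrC.
  under eq_bigr do rewrite term.
  case: (i : nat) => [|m].
    by rewrite big_ord_recl big_ord0 /= mulr0n scale0r addr0.
  rewrite !big_ord_recl /= add0r big1 ?addr0; last by move=> l _; rewrite /= /bump.
  by rewrite /bump /= bin1 subn1.
(* The formal derivative vanishes identically, and its coefficient of index [i] is [i.+1] times
   [c (lift ord0 i)]. *)
have c0 (i : 'I_N) : c (lift ord0 i) = 0.
  have := interp_coef0 (widen_ord (leqnSn N) i).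
  rewrite -[in X in X -> _](eq_interp_coef _ dq).
  under eq_interp_coef => s.
    rewrite big_ord_recl mulr0n scale0r add0r.
    under eq_bigr do rewrite /= -mulr_natr -scalerA.
    over.
  rewrite interp_coef_sum (bigD1 i)//= interp_coef_monomial; last exact: ltnW (ltn_ord _).
  rewrite eqxx big1 ?addr0 => [/eqP|j ji]; last first.
    rewrite interp_coef_monomial; last exact: ltnW (ltn_ord _).
    by rewrite /= val_eqE eq_sym (negPf ji).
  by rewrite scaler_eq0 pnatr_eq0 /= => /eqP.
rewrite !iq !big_ord_recl !expr0; congr (_ + _); apply: eq_bigr => i _.
by rewrite -/(c _) c0 !scaler0.
Qed.

End Coefficients.
End Interpolation.

(** * Homogeneous polynomials and their directional derivatives *)

Section HomogeneousPolynomials.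
Context {R : realType} {E Y : lmodType R}.
Implicit Types (P : E -> Y) (b x y : E).

(* Homogeneous polynomials, with the multilinear form curried one argument at a
   time. *)
Fixpoint hpoly n P : Prop :=
  if n is n'.+1 then
    exists F : E -> E -> Y,
      [/\ forall x, linear (F^~ x), forall b, hpoly n' (F b) & forall x, P x = F x x]
  else exists c, forall x, P x = c.

Lemma homogeneous_hpoly n P : homogeneous_polynomial n P -> hpoly n P.
Proof.
case=> phi; elim: n phi P => [|n IH] phi P phi_lin PE.
  by exists (phi (fun=> 0)) => x; rewrite PE; congr phi; apply/funext => -[].
pose cons b (v : 'I_n -> E) (i : 'I_n.+1) := if unlift ord0 i is Some j then v j else b.
exists (fun b x => phi (cons b (fun=> x))); split.
- move=> x a b1 b2.
  have consE b : cons b (fun=> x) = dfwith (cons 0 (fun=> x)) ord0 b.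
    apply/funext => i; have [<-|i0] := eqVneq ord0 i.
      by rewrite dfwithin /cons unlift_none.
    by rewrite dfwithout// /cons; case: unliftP i0 => // ->; rewrite eqxx.
  by rewrite (consE (a *: b1 + b2)) (consE b1) (consE b2) phi_lin.
- move=> b; apply: (IH (fun v => phi (cons b v))) => // v i a x y.
  have consE z : cons b (dfwith v i z) = dfwith (cons b v) (lift ord0 i) z.
    apply/funext => j; have [<-|ij] := eqVneq (lift ord0 i) j.
      by rewrite dfwithin /cons liftK dfwithin.
    rewrite dfwithout// /cons; case: unliftP ij => // k -> ij.
    by rewrite dfwithout//; apply: contra_neq ij => ->.
  by rewrite !consE phi_lin.
- move=> x; rewrite PE; congr phi; apply/funext => i; rewrite /cons.
  by case: unlift.
Qed.

Lemma eq_hpoly n P1 P2 : P1 =1 P2 -> hpoly n P1 -> hpoly n P2.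
Proof.
case: n => [|n] e [c]; first by move=> h; exists c => x; rewrite -e.
by case=> F_lin F_poly PE; exists c; split=> // x; rewrite -e.
Qed.

Lemma hpolyD n P1 P2 : hpoly n P1 -> hpoly n P2 -> hpoly n (fun x => P1 x + P2 x).
Proof.
elim: n P1 P2 => [|n IH] P1 P2 [F1 h1] [F2 h2].
  by exists (F1 + F2) => x; rewrite h1 h2.
case: h1 h2 => [l1 p1 e1] [l2 p2 e2].
exists (fun b x => F1 b x + F2 b x); split=> [x a b1 b2|b|x].
- by rewrite (l1 x) (l2 x) scalerDr addrACA.
- exact: (IH _ _ (p1 b) (p2 b)).
- by rewrite e1 e2.
Qed.

Lemma hpolyS0 n P : hpoly n.+1 P -> P 0 = 0.
Proof.
case=> F [F_lin _ ->]; have := F_lin 0 (-1) 0 0.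
by rewrite scaler0 addr0 scaleN1r addNr.
Qed.

Lemma hpoly1D P x y : hpoly 1 P -> P (x + y) = P x + P y.
Proof.
case=> F [F_lin F_const PE].
have FE b z : F b z = F b x by case: (F_const b) => c e; rewrite !e.
rewrite !PE (FE (x + y)) (FE y y); have := F_lin x 1 x y.
by rewrite !scale1r.
Qed.

Section Derivative.
Variable N : nat.

(** The factor [t ^+ k] carries the induction on [n]: expanding the first argument of [F] at
    [x + t *: y] gives one term with exponent [k] and one with exponent [k.+1], both of lower
    degree. *)
Lemma hpoly_interpolated n P k x y : hpoly n P -> (k + n <= N)%N ->
  interpolated N (fun t => t ^+ k *: P (x + t *: y)).
Proof.
elim: n P k => [|n IH] P k.
  case=> c PE; rewrite addn0 => kN.
  by apply: eq_interpolated (interpolated_monomial c kN) => t; rewrite PE.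
case=> F [F_lin F_poly PE] knN.
have knN' : (k + n <= N)%N by apply: leq_trans knN; rewrite leq_add2l.
have knS : (k.+1 + n <= N)%N by rewrite addSnnS.
have := interpolatedD (IH _ _ (F_poly x) knN') (IH _ _ (F_poly y) knS).
apply: eq_interpolated => t; rewrite PE.
have := F_lin (x + t *: y) t y x; rewrite [t *: y + x]addrC => ->.
by rewrite scalerDr scalerA exprSr addrC.
Qed.

(** Same recursion; the term with [t ^+ k.+1] does not reach the coefficients of index at most
    [k]. *)
Lemma hpoly_interp_coef_low n P k x y (i : 'I_N.+1) :
  hpoly n P -> (k + n <= N)%N -> (i <= k)%N ->
  interp_coef i (fun t => t ^+ k *: P (x + t *: y)) = if i == k :> nat then P x else 0.
Proof.
elim: n P k => [|n IH] P k.
  case=> c PE; rewrite addn0 => kN _.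
  rewrite PE -interp_coef_monomial//.
  by apply: eq_interp_coef => t; rewrite PE.
case=> F [F_lin F_poly PE] knN ik.
have knN' : (k + n <= N)%N by apply: leq_trans knN; rewrite leq_add2l.
have knS : (k.+1 + n <= N)%N by rewrite addSnnS.
rewrite PE -(IH _ _ (F_poly x) knN' ik) -[RHS]add0r.
have <- : interp_coef i (fun t => t ^+ k.+1 *: F y (x + t *: y)) = 0.
  by rewrite (IH _ _ (F_poly y) knS (leqW ik)) ltn_eqF.
rewrite -interp_coefD; apply: eq_interp_coef => t; rewrite PE.
have := F_lin (x + t *: y) t y x; rewrite [t *: y + x]addrC => ->.
by rewrite scalerDr scalerA exprSr.
Qed.

(** When [P] has degree at most [N], this is its derivative at [x] in direction [b], obtained
    without any limit in [Y]. *)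
Definition deriv b P x : Y :=
  interp_coef (inord 1 : 'I_N.+1) (fun t => P (x + t *: b)).

Lemma deriv_linear b x a P1 P2 :
  deriv b (fun x => a *: P1 x + P2 x) x = a *: deriv b P1 x + deriv b P2 x.
Proof. exact: interp_coefP. Qed.

Lemma eq_deriv b P1 P2 x : P1 =1 P2 -> deriv b P1 x = deriv b P2 x.
Proof. by move=> e; apply: eq_interp_coef => t. Qed.

(* Product rule for [x |-> F x x]. *)
Lemma deriv_diag n (F : E -> E -> Y) b x : (n < N)%N ->
  (forall x, linear (F^~ x)) -> (forall b, hpoly n (F b)) ->
  deriv b (fun x => F x x) x = deriv b (F x) x + F b x.
Proof.
move=> nN F_lin F_poly.
have i1 : (inord 1 : 'I_N.+1) = 1%N :> nat.
  by rewrite inordK// ltnS (leq_ltn_trans _ nN).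
have -> : F b x = interp_coef (inord 1 : 'I_N.+1) (fun t => t ^+ 1 *: F b (x + t *: b)).
  by rewrite (hpoly_interp_coef_low _ _ (F_poly b)) ?i1.
rewrite -interp_coefD; apply: eq_interp_coef => t.
have := F_lin (x + t *: b) t b x; rewrite [t *: b + x]addrC => ->.
by rewrite addrC expr1.
Qed.

Lemma deriv_const b x c : (0 < N)%N -> deriv b (fun=> c) x = 0.
Proof.
move=> N0; have := @interp_coef_monomial R N Y (inord 1) 0 c isT.
rewrite inordK//= => <-.
by apply: eq_interp_coef => t; rewrite expr0 scale1r.
Qed.

(** By the product rule the derivative is [deriv b (F x) x + F b x]. The first term is the diagonal
    of a map linear in the argument of [F], and the induction hypothesis handles each [F x]. *)
Lemma hpoly_deriv n P : (n < N)%N -> hpoly n.+1 P ->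
  (forall b, hpoly n (deriv b P)) /\ (forall x, linear (fun b => deriv b P x)).
Proof.
elim: n P => [|n IH] P nN [F [F_lin F_poly PE]].
  have dE b x : F b x = deriv b P x.
    rewrite (eq_deriv _ _ PE) (deriv_diag _ _ nN)//.
    have [c Fc] := F_poly x.
    by rewrite (eq_deriv _ _ Fc) deriv_const// add0r.
  split=> [b|x a b1 b2]; last by rewrite -!dE F_lin.
  exact: (@eq_hpoly 0 _ _ (dE b) (F_poly b)).
have dE b x : deriv b (F x) x + F b x = deriv b P x.
  by rewrite (eq_deriv _ _ PE) (deriv_diag _ _ nN).
have dF x := IH _ (ltnW nN) (F_poly x).
split=> [b|x a b1 b2].
  apply: (@eq_hpoly n.+1 _ _ (dE b)); apply: hpolyD; last exact: F_poly.
  exists (fun a x => deriv b (F a) x); split=> // [x a b1 b2|a].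
    by rewrite -deriv_linear; apply: eq_deriv => y; rewrite F_lin.
  exact: (dF a).1.
by rewrite -!dE F_lin (dF x).2 scalerDr addrACA.
Qed.

End Derivative.
End HomogeneousPolynomials.

(** * Bounded images and separation *)

Section BoundedImages.
Context {R : realType} {Y : convexBornologicalType R} {T : Type}.
Implicit Types (A : set T) (F G : T -> Y) (y : Y).

Lemma bornology_set1 y : bornology [set y].
Proof.
have : setT y by [].
rewrite -bornology_cover => -[B bB By].
by apply: (bornologyS _ _ _ bB) => _ ->.
Qed.

Lemma bornology_imageD A F G : bornology (F @` A) -> bornology (G @` A) ->
  bornology ((fun t => F t + G t) @` A).
Proof.
move=> bF bG; apply: (bornologyS _ _ _ (bornologyD _ _ bF bG)) => _ [t At <-].
by exists (F t); [exists t|exists (G t) => //; exists t].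
Qed.

(** The scalar may vary with the point, because the new image stays in the balanced hull of the old
    one. *)
Lemma bornology_imageZ A (c : T -> R) F : (forall t, A t -> `|c t| <= 1) ->
  bornology (F @` A) -> bornology ((fun t => c t *: F t) @` A).
Proof.
move=> c1 bF; apply: (bornologyS _ _ _ (bornology_balanced_hull _ bF)) => _ [t At <-].
by move=> B [bB FB]; apply: bB; [exact: c1|apply: FB; exists t].
Qed.

Lemma bornology_imageZl A a F : bornology (F @` A) ->
  bornology ((fun t => a *: F t) @` A).
Proof.
move=> bF; apply: (bornologyS _ _ _ (bornologyZ a _ bF)) => _ [t At <-].
by exists (F t) => //; exists t.
Qed.

Lemma bornology_image_cst A y : bornology ((fun=> y) @` A).
Proof. by apply: (bornologyS _ _ _ (bornology_set1 y)) => _ [t _ <-]. Qed.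

Lemma bornology_image_sum A (I : Type) (r : seq I) (F : I -> T -> Y) :
  (forall i, bornology (F i @` A)) ->
  bornology ((fun t => \sum_(i <- r) F i t) @` A).
Proof.
move=> bF; elim: r => [|i r IH].
  by under eq_fun do rewrite big_nil; exact: bornology_image_cst.
by under eq_fun do rewrite big_cons; exact: bornology_imageD.
Qed.

(** Asking for [t >= 0] covers all nodes and lets order bounds that depend on the sign of [t] be
    used. *)
Lemma bornology_image_interp_coef N (i : 'I_N.+1) A (F : T -> R -> Y) :
  (forall t, 0 <= t -> bornology ((fun x => F x t) @` A)) ->
  bornology ((fun x => interp_coef i (F x)) @` A).
Proof.
move=> bF; apply: bornology_image_sum => j.
by apply: bornology_imageZl; exact: bF.
Qed.

Lemma bounded_map_comp {E : vectorLatticeType R} (P : E -> Y) A (g : T -> E) a b :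
  bounded_map P -> (forall t, A t -> a <= g t <= b) ->
  bornology ((fun t => P (g t)) @` A).
Proof.
move=> bP gab; have /bP : order_bounded (g @` A).
  by exists a, b => _ [t At <-] /=; rewrite in_itv /= gab.
by apply: bornologyS => _ [t At <-]; exists (g t) => //; exists t.
Qed.

End BoundedImages.

(** The factors [e^-1] are arbitrarily large, so the balanced hull contains the whole line through
    [w]; in a separated space a bounded line is trivial. *)
Lemma separated_eq0 (R : realType) (Y : convexBornologicalType R) (w : Y) :
  separated Y -> bornology ((fun e : R => e^-1 *: w) @` [set e | 0 < e <= 1]) ->
  w = 0.
Proof.
move=> sepY bw.
pose V : set Y := [set c *: w | c in setT].
suff V0 : V = [set 0].
  suff : V w by rewrite V0.
  by exists 1 => //; rewrite scale1r.
apply: sepY.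
  split=> [|a u v]; first by apply/mem_set; exists 0 => //; rewrite scale0r.
  move=> /set_mem[c _ <-] /set_mem[d _ <-]; apply/mem_set.
  by exists (a * c + d) => //; rewrite scalerDl scalerA.
apply: (bornologyS _ _ _ (bornology_balanced_hull _ bw)) => _ [c _ <-] B [bB wB].
(* Chosen so that both [e <= 1] and [c * e] has absolute value at most 1. *)
pose e : R := (1 + `|c|)^-1.
have e0 : 0 < 1 + `|c| by rewrite ltr_pwDl.
have -> : c *: w = (c * e) *: (e^-1 *: w).
  by rewrite scalerA /e invrK mulfVK// gt_eqF.
apply: bB.
  by rewrite normrM normfV (ger0_norm (ltW e0)) ler_pdivrMr// mul1r lerDr.
apply: wB; exists e => //=.
by rewrite /e invr_gt0 e0 invf_le1// lerDl normr_ge0.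
Qed.

Lemma bounded_map_deriv (R : realType) (E : vectorLatticeType R)
    (Y : convexBornologicalType R) N (P : E -> Y) b :
  bounded_map P -> bounded_map (deriv N b P).
Proof.
move=> bP A [l [u Alu]]; apply: bornology_image_interp_coef => t _.
apply: (bounded_map_comp (a := l + t *: b) (b := u + t *: b)) bP _ => x /Alu /=.
by rewrite in_itv /= !vlat_leD2rE.
Qed.

(** * From orthogonal additivity to the valuation identity *)

Section Valuation.
Context {R : realType} {E : vectorLatticeType R} {Y : convexBornologicalType R}.
Implicit Types (P : E -> Y) (b c u v x y : E).

Local Notation "x ∨ y" := (Order.join (x : E) (y : E)) (at level 50, left associativity).
Local Notation "x ∧ y" := (Order.meet (x : E) (y : E)) (at level 48, left associativity).

Definition positively_orthogonally_additive P : Prop :=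
  forall u v, 0 <= u -> 0 <= v -> u ∧ v = 0 -> P (u + v) = P u + P v.

Definition valuation P : Prop :=
  forall x y, P (x ∨ y) + P (x ∧ y) = P x + P y.

(** At every node [j], the element [j%:R *: c] is disjoint from [y], so moving along [c] changes
    [P (x + y)] only through [x]. For the same reason the derivative at [y] equals the one at 0. *)
Lemma deriv_disjoint N P c x y : (0 < N)%N ->
  positively_orthogonally_additive P -> deriv N c P 0 = 0 ->
  0 <= c -> 0 <= x -> 0 <= y -> c ∧ y = 0 -> x ∧ y = 0 ->
  deriv N c P (x + y) = deriv N c P x + deriv N c P y.
Proof.
move=> N0 oaP d0 c0 x0 y0 cy xy.
have jc (j : 'I_N.+1) : 0 <= (j : nat)%:R *: c by rewrite vlat_scaler_ge0.
have jcy (j : 'I_N.+1) : (j : nat)%:R *: c ∧ y = 0 by rewrite disjointZ.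
have -> : deriv N c P y = 0.
  rewrite -d0 -[RHS]add0r -(deriv_const c 0 (P y) N0) -interp_coefD.
  apply: eq_nodes_interp_coef => j.
  by rewrite add0r [y + _]addrC oaP// addrC.
rewrite -(deriv_const c 0 (P y) N0) -interp_coefD.
apply: eq_nodes_interp_coef => j.
by rewrite addrAC oaP// ?vlat_addr_ge0// disjoint_addl.
Qed.

(* For [b >= 0] and [e > 0], [b] splits as [b ∧ (u / e)], which is disjoint from
   [v], plus [(b - u / e)^+], which is disjoint from [(u - e b)^+]; so the
   derivative along [b] is additive at [(u - e b)^+] and [v], and boundedness
   gives the limit [e -> 0]. *)
Lemma deriv_positively_oa_pos N n P b : separated Y -> (n.+1 < N)%N ->
  hpoly n.+2 P -> bounded_map P -> positively_orthogonally_additive P ->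
  0 <= b -> positively_orthogonally_additive (deriv N b P).
Proof.
move=> sepY nN hP bP oaP b0 u v u0 v0 uv.
have N0 : (0 < N)%N by apply: leq_ltn_trans nN.
have [hD linD] := hpoly_deriv nN hP.
have D0 c : deriv N c P 0 = 0 := hpolyS0 (hD c).
pose Q := deriv N b P.
pose W x := Q (x + v) - Q x - Q v.
have DD c d x : deriv N (c + d) P x = deriv N c P x + deriv N d P x.
  by have := linD x 1 c d; rewrite !scale1r.
(* This is [b ∧ (u / e)]: it stays in [[0, b]] for every [e], while [u - e *: y e] is the positive
   part of [u - e *: b]. *)
pose y e := e^-1 *: (u ∧ (e *: b)).
have yb e : 0 < e -> 0 <= y e <= b.
  move=> e0; rewrite vlat_scaler_ge0 ?invr_ge0 ?(ltW e0)//=; last first.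
    by rewrite lexI u0 vlat_scaler_ge0// ltW.
  rewrite -(vlat_ler_pZ _ _ e0) scalerA mulfV ?gt_eqF// scale1r.
  exact: leIr.
have uE e : 0 < e -> u - e *: y e = (u - e *: b) ∨ 0.
  by move=> e0; rewrite scalerA mulfV ?gt_eqF// scale1r vlat_subI.
have W0 e : 0 < e -> W (u - e *: y e) = 0.
  move=> e0; rewrite uE//; set ue := _ ∨ _.
  have ue0 : 0 <= ue by rewrite leUr.
  have ueu : ue <= u.
    rewrite leUx u0 andbT vlat_le_subl -[leLHS]addr0 vlat_leD//.
    by rewrite vlat_scaler_ge0// ltW.
  have eV : 0 <= e^-1 by rewrite invr_ge0 ltW.
  have uev : ue ∧ v = 0 := disjoint_le ue0 v0 ueu (lexx v) uv.
  pose b1 := b ∧ (e^-1 *: u); pose b2 := b - b1.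
  have b10 : 0 <= b1 by rewrite lexI b0 vlat_scaler_ge0.
  have b20 : 0 <= b2 by rewrite vlat_subr_ge0 leIl.
  have b1v : b1 ∧ v = 0.
    apply: (disjoint_le b10 v0 _ (lexx v) (disjointZ eV u0 v0 uv)).
    exact: leIr.
  have b2ue : b2 ∧ ue = 0.
    have -> : b2 = e^-1 *: ((- (u - e *: b)) ∨ 0).
      rewrite opprB -vlat_subI scalerBr vlat_meetZ ?invr_gt0// scalerA.
      by rewrite mulVf ?gt_eqF// scale1r.
    by rewrite disjointZ ?leUr// meetC disjoint_pos_neg.
  have -> : W ue = deriv N (b1 + b2) P (ue + v)
      - deriv N (b1 + b2) P ue - deriv N (b1 + b2) P v.
    by rewrite [b1 + b2]addrC subrK.
  rewrite !(DD b1 b2) (deriv_disjoint N0 oaP (D0 b1))//.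
  rewrite (addrC ue v) (deriv_disjoint N0 oaP (D0 b2))//; last by rewrite meetC.
  rewrite -addrA -opprD.
  by rewrite [X in _ - X]addrACA [deriv N b2 P ue + _]addrC subrr.
suff : W u = 0 by move/eqP; rewrite /W -addrA -opprD subr_eq0 => /eqP.
apply: separated_eq0 sepY _.
(* This polynomial joins [W u] at [t = 0] to the value 0 at [t = e]. *)
pose q e t := W (u + t *: - y e).
have iq e : interpolated N (q e).
  have iQ x z : interpolated N (fun t => Q (x + t *: z)).
    have := @hpoly_interpolated R E Y N n.+1 Q 0 x z (hD b) (ltnW nN).
    by apply: eq_interpolated => t; rewrite expr0 scale1r.
  have iW := interpolatedB (interpolatedB (iQ (u + v) (- y e)) (iQ u (- y e)))
    (iQ v 0).
  by apply: eq_interpolated iW => t; rewrite scaler0 addr0 [u + v + _]addrAC.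
(* Solve [q e e = 0] for the constant term [W u]; the remaining terms are divisible by [e]. *)
have Wu e : 0 < e ->
    e^-1 *: W u = \sum_(i < N) (- e ^+ i) *: interp_coef (lift ord0 i) (q e).
  move=> e0; have := iq e e.
  rewrite {1}/q scalerN W0// big_ord_recl expr0 scale1r interpolated_at0//.
  rewrite {1}/q scale0r addr0 => /esym/eqP; rewrite addr_eq0 => /eqP ->.
  rewrite -sumrN scaler_sumr; apply: eq_bigr => i _.
  by rewrite scalerN scalerA scaleNr /= exprS mulKf// gt_eqF.
(* Since [0 <= y e <= b], the arguments of [Q] lie in an order interval independent of [e]. *)
have bQ c t : 0 <= t ->
    bornology ((fun e => Q (u + t *: - y e + c)) @` [set e | 0 < e <= 1]).
  move=> t0; have := @bounded_map_comp _ _ _ E Q [set e | 0 < e <= 1]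
    (fun e => u + t *: - y e + c) (u - t *: b + c) (u + c).
  apply=> [|e]; first exact: bounded_map_deriv.
  move=> /= /andP[e0 _].
  have /andP[y0 yle] := yb _ e0.
  rewrite !vlat_leD2rE ![u + _]addrC vlat_leD2rE scalerN vlat_leN2.
  rewrite vlat_ler_wpZ//= -[leRHS]add0r vlat_leD2rE -vlat_oppr_ge0 opprK.
  by rewrite vlat_scaler_ge0.
apply: (bornologyS _ ((fun e => \sum_(i < N)
  (- e ^+ i) *: interp_coef (lift ord0 i) (q e)) @` [set e | 0 < e <= 1])).
  by move=> _ [e /= e01 <-]; exists e => //; rewrite Wu//; case/andP: e01.
apply: bornology_image_sum => i; apply: bornology_imageZ => [e /= /andP[e0 e1]|].
  by rewrite normrN normrX exprn_ile1// ger0_norm// ltW.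
apply: bornology_image_interp_coef => t t0.
have bQ0 : bornology ((fun e => Q (u + t *: - y e)) @` [set e | 0 < e <= 1]).
  by apply: (bornologyS _ _ _ (bQ 0 t t0)) => _ [e e01 <-]; exists e; rewrite ?addr0.
apply: bornology_imageD (bornology_image_cst _ (- Q v)).
apply: bornology_imageD (bQ v t t0) _.
apply: (bornologyS _ _ _ (bornology_imageZl (-1) bQ0)) => _ [e e01 <-].
by exists e; rewrite ?scaleN1r.
Qed.

(** Linearity in the direction reduces to the positive and negative parts of [b]. *)
Lemma deriv_positively_oa N n P b : separated Y -> (n.+1 < N)%N ->
  hpoly n.+2 P -> bounded_map P -> positively_orthogonally_additive P ->
  positively_orthogonally_additive (deriv N b P).
Proof.
move=> sepY nN hP bP oaP u v u0 v0 uv.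
have [_ linD] := hpoly_deriv nN hP.
pose bp := b ∨ 0; pose bn := (- b) ∨ 0.
have DE x : deriv N b P x = deriv N bp P x - deriv N bn P x.
  have -> : b = -1 *: bn + bp by rewrite scaleN1r addrC -joinDopp.
  by have /= -> := linD x (-1) bn bp; rewrite scaleN1r addrC.
rewrite !DE !(deriv_positively_oa_pos sepY nN hP bP oaP)// ?leUr//.
by rewrite opprD addrACA.
Qed.

(* With [a = x ∧ y], [u = x - a] and [v = y - a], the polynomial
   [t |-> P (t a + u + v) + P (t a) - P (t a + u) - P (t a + v)] vanishes at [0]
   since [u] and [v] are disjoint, and its derivative vanishes by induction,
   being the same expression for the derivative of [P] along [a]. *)
Lemma positively_oa_valuation n P : separated Y -> hpoly n.+1 P ->
  bounded_map P -> positively_orthogonally_additive P -> valuation P.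
Proof.
move=> sepY; elim: n P => [|n IH] P hP bP oaP x y.
  by rewrite -!(hpoly1D _ _ hP) vlat_joinDmeet.
pose N := n.+2; have nN : (n.+1 < N)%N by [].
pose a := x ∧ y; pose u := x - a; pose v := y - a.
have u0 : 0 <= u by rewrite vlat_subr_ge0 leIl.
have v0 : 0 <= v by rewrite vlat_subr_ge0 leIr.
have uv : u ∧ v = 0 by rewrite -vlat_meetDr subrr.
have uvU : u ∨ v = u + v := join_disjoint uv.
pose g t := P (u + v + t *: a) + P (0 + t *: a) - (P (u + t *: a) + P (v + t *: a)).
have iP z : interpolated N (fun t => P (z + t *: a)).
  have := @hpoly_interpolated R E Y N n.+2 P 0 z a hP (leqnn _).
  by apply: eq_interpolated => t; rewrite expr0 scale1r.
have ig : interpolated N g.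
  exact: interpolatedB (interpolatedD (iP _) (iP _)) (interpolatedD (iP _) (iP _)).
have dg s : interp_coef (inord 1 : 'I_N.+1) (fun t => g (s + t)) = 0.
  have [hD _] := hpoly_deriv nN hP.
  have dval := IH _ (hD a) (bounded_map_deriv N a bP)
    (deriv_positively_oa a sepY nN hP bP oaP).
  (* Translation by [s *: a] commutes with join and meet, so the valuation identity here has
     arguments [u + v + s *: a] and [s *: a] on its left side. *)
  have := dval (u + s *: a) (v + s *: a).
  rewrite -vlat_joinDr -vlat_meetDr uv uvU => /eqP.
  rewrite -subr_eq0 => /eqP <-.
  rewrite -!interp_coefD -interp_coefB; apply: eq_interp_coef => t.
  by rewrite /g !scalerDl !addrA add0r.
have := interpolated_derive0 (ltn0Sn n.+1) ig dg.
rewrite /g !scale0r !addr0 !scale1r add0r -(oaP u v)// (hpolyS0 hP) addr0 subrr.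
rewrite subrK [v + a]subrK => /eqP; rewrite subr_eq0 => /eqP <-.
by rewrite -uvU vlat_joinDr !subrK.
Qed.

(** By [join_abs_disjoint] the pairs [f, g] and [f + g, 0] have the same join and the same meet,
    hence the same sum of values. *)
Lemma valuation_orthogonally_additive P : P 0 = 0 -> valuation P ->
  orthogonally_additive P.
Proof.
move=> P0 vP f g /join_abs_disjoint[fgU fgI].
by rewrite -vP fgU fgI vP P0 addr0.
Qed.

Lemma oa_positively_oa P : orthogonally_additive P ->
  positively_orthogonally_additive P.
Proof. by move=> oaP u v u0 v0 uv; apply: oaP; rewrite !vabs_ge0_id. Qed.

End Valuation.

(** * Sorting by joins and meets *)

(* Inserting [x] into a decreasing sequence by successive comparisons replaces a
   pair by its join and meet at each step, which preserves the sum of the values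
   of a valuation. *)
Section OrderStatistics.
Context {R : realType} {E : vectorLatticeType R}.
Implicit Types (a x y z : E) (s c t : seq E).

Local Notation "x ∨ y" := (Order.join (x : E) (y : E)) (at level 50, left associativity).
Local Notation "x ∧ y" := (Order.meet (x : E) (y : E)) (at level 48, left associativity).
Local Notation decreasing := (sorted (fun x y : E => y <= x)).

Fixpoint lattice_insert x s : seq E :=
  if s is y :: s' then (y ∨ x) :: lattice_insert (y ∧ x) s' else [:: x].

Definition lattice_sort s : seq E := foldr lattice_insert [::] s.

Lemma size_lattice_insert x s : size (lattice_insert x s) = (size s).+1.
Proof. by elim: s x => [|y s IH] x //=; rewrite IH. Qed.

Lemma size_lattice_sort s : size (lattice_sort s) = size s.
Proof. by elim: s => [|x s IH] //=; rewrite size_lattice_insert IH. Qed.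

Lemma lattice_insert_decreasing x s : decreasing s -> decreasing (lattice_insert x s).
Proof.
elim: s x => [|y s IH] x //= ys; have := IH (y ∧ x) (path_sorted ys).
case: s ys {IH} => [|w s] /=; first by move=> _ _; rewrite andbT leIxl// leUl.
case/andP=> wy _ ->; rewrite andbT leUx (leIxl _ (leUl _ _)) andbT.
by rewrite (le_trans wy)// leUl.
Qed.

Lemma lattice_sort_decreasing s : decreasing (lattice_sort s).
Proof. by elim: s => [|x s IH] //=; apply: lattice_insert_decreasing. Qed.

(** The element carried past position [m] is the meet of [x] with all entries so far, and in a
    decreasing sequence the last of these absorbs the others. The case split keeps the default 0 of
    [nth] out of the join at the end of the sequence. *)
Lemma nth_lattice_insertS x s m : decreasing s -> (m < size s)%N ->
  nth 0 (lattice_insert x s) m.+1 =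
  if (m.+1 < size s)%N then nth 0 s m.+1 ∨ (nth 0 s m ∧ x) else nth 0 s m ∧ x.
Proof.
elim: s x m => [|y s IH] x m //= ys ms.
case: m ms => [|m] ms; first by case: s ys ms {IH} => [|w s] //=.
rewrite IH ?(path_sorted ys)// ltnS.
have ym : nth 0 s m <= y.
  have tr : transitive (fun x y : E => y <= x).
    by move=> p q o pq qo; apply: le_trans qo pq.
  by have /allP := order_path_min tr ys; apply; rewrite mem_nth.
by rewrite meetA (meet_l ym).
Qed.

Lemma sum_lattice_sort (Y : convexBornologicalType R) (P : E -> Y) s :
  valuation P -> \sum_(y <- lattice_sort s) P y = \sum_(y <- s) P y.
Proof.
move=> vP.
have sum_ins x c : \sum_(y <- lattice_insert x c) P y = P x + \sum_(y <- c) P y.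
  elim: c x => [|y c IH] x /=; first by rewrite !big_cons.
  by rewrite !big_cons IH addrA vP [P y + _]addrC -addrA.
by elim: s => [|x s IH] //=; rewrite sum_ins IH big_cons.
Qed.

Lemma le_bigmeet w a t :
  (w <= \big[Order.meet/a]_(y <- t) y) = (w <= a) && all (fun y => w <= y) t.
Proof.
by elim: t => [|y t IH]; rewrite ?big_nil ?andbT// big_cons lexI IH /= andbCA.
Qed.

Lemma le_fin_meet w t : (0 < size t)%N ->
  (w <= fin_meet t) = all (fun y => w <= y) t.
Proof. by case: t => //= y t _; rewrite le_bigmeet. Qed.

Lemma fin_join_le s z : (0 < size s)%N ->
  (fin_join s <= z) = all (fun y => y <= z) s.
Proof.
case: s => //= y s _; elim: s => [|x s IH]; first by rewrite big_nil /= andbT.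
by rewrite big_cons leUx IH /= andbCA.
Qed.

Lemma bigmeet_cons a x t :
  \big[Order.meet/a]_(y <- x :: t) y = \big[Order.meet/a ∧ x]_(y <- t) y.
Proof.
rewrite big_cons; elim: t => [|y t IH]; first by rewrite !big_nil meetC.
by rewrite !big_cons meetCA IH.
Qed.

Lemma subseq_consP (T : eqType) (Q : seq T -> Prop) (x : T) (u : seq T) m :
  (forall v, subseq v (x :: u) -> size v = m.+1 -> Q v) <->
  (forall v, subseq v u -> size v = m.+1 -> Q v) /\
  (forall v, subseq v u -> size v = m -> Q (x :: v)).
Proof.
split=> [h|[h1 h2] [|y v] //=].
  split=> v vu vm; first by apply: h => //; apply: subseq_trans vu (subseq_cons _ _).
  by apply: h => /=; rewrite ?eqxx ?vm.
by case: eqP => [-> vu [vm]|_ vu vm]; [apply: h2|apply: h1].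
Qed.

(* The extra meet with [a] makes the induction go through without adding a top
   element for the meet of the empty sequence. *)
Lemma meet_nth_lattice_sort_le s m a z : (m < size s)%N ->
  a ∧ nth 0 (lattice_sort s) m <= z <->
  (forall t, subseq t s -> size t = m.+1 -> \big[Order.meet/a]_(y <- t) y <= z).
Proof.
elim: s m a => [|x s IH] //= m a ms.
rewrite subseq_consP; set c := lattice_sort s in IH *.
have sc : size c = size s := size_lattice_sort s.
(* Past the end of [s] the condition on subsequences avoiding [x] is vacuous. *)
have short k : (size s <= k)%N -> forall t, subseq t s -> size t = k.+1 ->
    \big[Order.meet/a]_(y <- t) y <= z.
  by move=> sk t /size_subseq + tk; rewrite tk leqNgt ltnS sk.
case: m ms => [|m] ms.
  have -> : (forall t, subseq t s -> size t = 0 ->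
      \big[Order.meet/a]_(y <- x :: t) y <= z) <-> a ∧ x <= z.
    split=> [/(_ [::])|axz [|//] _ _].
      by rewrite big_cons big_nil meetC; apply=> //; exact: sub0seq.
    by rewrite big_cons big_nil meetC.
  case cE : c sc => [|y c'] /= sc.
    by split=> [|[]//]; split=> //; apply: short; rewrite -sc.
  have := IH 0 a; rewrite cE -sc => /(_ isT) /= <-.
  by rewrite vlat_meetUr leUx; split=> [/andP//|[-> ->]].
(* For the subsequences that use [x], absorb [x] into [a] and apply the induction hypothesis to
   [a ∧ x]. *)
have -> : (forall t, subseq t s -> size t = m.+1 ->
    \big[Order.meet/a]_(y <- x :: t) y <= z) <-> (a ∧ x) ∧ nth 0 c m <= z.
  rewrite IH//; split=> h t ts tm.
    by rewrite -bigmeet_cons; apply: h.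
  by rewrite bigmeet_cons; apply: h.
rewrite /= nth_lattice_insertS ?sc//; last exact: lattice_sort_decreasing.
rewrite -meetA [x ∧ _]meetC; case: ltnP => sm.
  by rewrite -IH// vlat_meetUr leUx; split=> [/andP//|[-> ->]].
by split=> [|[]//]; split=> //; apply: short.
Qed.

End OrderStatistics.

(** * The elements [M_ k f] as entries of the sorted sequence *)

Lemma sorted_val_subseq_enum r (u : seq 'I_r) :
  sorted ltn [seq val j | j <- u] = subseq u (enum 'I_r).
Proof.
have val_sorted v : sorted ltn [seq val j | j <- v] = sorted (fun i j : 'I_r => (i < j)%N) v.
  by rewrite sorted_map.
apply/idP/idP => [u_sorted|u_sub]; last first.
  apply: (subseq_sorted ltn_trans (map_subseq val u_sub)).
  by rewrite val_enum_ord iota_ltn_sorted.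
(* Both lists are strictly increasing with the same elements. *)
suff -> : u = [seq j <- enum 'I_r | j \in u] by apply: filter_subseq.
have tr : transitive (fun i j : 'I_r => (i < j)%N).
  by move=> j i k; apply: ltn_trans.
apply: (irr_sorted_eq tr) => [i||| i]; first exact: ltnn.
- by rewrite -val_sorted.
- apply: (sorted_filter tr).
  by rewrite -val_sorted val_enum_ord iota_ltn_sorted.
- by rewrite mem_filter mem_enum andbT.
Qed.

Lemma subseq_mapP (T1 T2 : eqType) (f : T1 -> T2) (s : seq T1) (t : seq T2) :
  subseq t (map f s) -> exists2 u, subseq u s & t = map f u.
Proof.
case/subseqP => m sm ->; exists (mask m s); last by rewrite map_mask.
exact: mask_subseq.
Qed.

Section MLatticeSort.
Context {R : realType} {E : vectorLatticeType R}.

(** The meets in [M_ k f] run over [r.+1 - k] entries and the sorted sequence is indexed from 0,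
    whence position [r - k]. Each inequality follows from [meet_nth_lattice_sort_le] with a suitable
    [a]: first the meet in question, then [c] itself. *)
Lemma M_nth_lattice_sort r k (f : 'I_r -> E) : (0 < k <= r)%N ->
  M_ k f = nth 0 (lattice_sort [seq f i | i <- enum 'I_r]) (r - k).
Proof.
move=> /andP[k0 kr].
set s := [seq f i | i <- enum 'I_r]; set c := nth 0 _ _.
have ss : size s = r by rewrite size_map size_enum_ord.
have lt_s : (r - k < size s)%N by rewrite ss ltn_subrL k0 (leq_trans k0).
have rk : (r.+1 - k = (r - k).+1)%N by rewrite subSn.
rewrite /M_; set L := map _ _.
have L_in t : subseq t s -> size t = (r - k).+1 -> fin_meet t \in L.
  move=> /subseq_mapP[u u_sub ->]; rewrite size_map -rk => /eqP su.
  apply/mapP; exists (Tuple su) => //.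
  by rewrite mem_filter mem_enum /= sorted_val_subseq_enum u_sub.
have L_sub y : y \in L -> exists t, [/\ subseq t s, size t = (r - k).+1 & y = fin_meet t].
  case/mapP => u; rewrite mem_filter mem_enum sorted_val_subseq_enum.
  rewrite andbT => u_sub ->; exists [seq f j | j <- u].
  by split=> //; [exact: map_subseq|rewrite -rk size_map size_tuple].
have L0 : (0 < size L)%N.
  have : fin_meet (take (r - k).+1 s) \in L.
    by apply: L_in; [exact: take_subseq|rewrite size_takel].
  by case: (L).
apply/le_anti/andP; split.
  rewrite fin_join_le//; apply/allP => y /L_sub[t [ts st ->]].
  have := (@meet_nth_lattice_sort_le _ _ s (r - k) (fin_meet t) c lt_s).1 (leIr _ _) t ts st.
  by apply: le_trans; rewrite le_bigmeet lexx -le_fin_meet ?st /=.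
have := (@meet_nth_lattice_sort_le _ _ s (r - k) c (fin_join L) lt_s).2.
rewrite -/c meetxx; apply => t ts st.
apply: (@le_trans _ _ (fin_meet t)).
  rewrite le_fin_meet ?st//; have := lexx (\big[Order.meet/c]_(y <- t) y).
  by rewrite le_bigmeet => /andP[].
have := lexx (fin_join L); rewrite fin_join_le// => /allP; apply.
exact: L_in.
Qed.

Lemma sum_M (Y : convexBornologicalType R) (P : E -> Y) r (f : 'I_r -> E) :
  \sum_(1 <= k < r.+1) P (M_ k f) =
  \sum_(y <- lattice_sort [seq f i | i <- enum 'I_r]) P y.
Proof.
rewrite [RHS](big_nth 0) size_lattice_sort size_map size_enum_ord.
(* [M_ k f] sits at position [r - k], so the order of summation is reversed. *)
rewrite big_nat_rev big_add1 /=; apply: eq_big_nat => i /andP[_ ir].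
rewrite add1n subSS subSS M_nth_lattice_sort ?subn_gt0 ?ir ?leq_subr//.
by rewrite subKn// ltnW.
Qed.

(** Test the identity on [u, v, 0, ..., 0], which sorts to [u + v, 0, ..., 0] when [u] and [v] are
    disjoint. *)
Lemma positively_oa_of_sum_M (Y : convexBornologicalType R) (P : E -> Y) r :
  P 0 = 0 ->
  (forall f : 'I_r.+2 -> E, (forall i, 0 <= f i) ->
    \sum_(k < r.+2) P (f k) = \sum_(1 <= k < r.+3) P (M_ k f)) ->
  positively_orthogonally_additive P.
Proof.
move=> P0 PM u v u0 v0 uv.
pose s := [:: u, v & nseq r 0].
have s0 i : 0 <= nth 0 s i.
  by case: i => [|[|i]] //=; rewrite nth_nseq if_same.
have := PM (fun i => nth 0 s i) (fun i => s0 i).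
rewrite sum_M.
have -> : [seq nth 0 s i | i : 'I_r.+2 <- enum 'I_r.+2] = s.
  apply: (@eq_from_nth _ 0); rewrite size_map size_enum_ord /= ?size_nseq// => i ir.
  by rewrite (nth_map ord0) ?size_enum_ord// nth_enum_ord.
have ins0 n x : 0 <= x -> lattice_insert x (nseq n 0) = x :: nseq n 0.
  elim: n x => [|n IH] x x0 //=.
  by rewrite (join_r x0) (meet_l x0) IH.
have sort0 n : lattice_sort (nseq n (0 : E)) = nseq n 0.
  by elim: n => //= n ->; rewrite ins0.
rewrite /= sort0 ins0//= meetC uv joinC ins0// (join_disjoint uv).
have P0s : \sum_(y <- nseq r 0) P y = 0.
  by rewrite big1_seq// => y /andP[_]; rewrite mem_nseq => /andP[_ /eqP ->].
rewrite !big_cons P0 P0s !addr0 => <-.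
rewrite !big_ord_recl /= big1 ?addr0// => i _.
by rewrite nth_nseq if_same P0.
Qed.

End MLatticeSort.

Theorem corollary3p22 (R : realType) (n r : nat) (hn : (0 < n)%N) (hr : (2 <= r)%N)
    (E : vectorLatticeType R) (Y : convexBornologicalType R)
    (hE0 : nontrivial E) (hEa : archimedean E) (hEu : uniformly_complete E)
    (hY : separated Y)
    (P : E -> Y) (hP : homogeneous_polynomial n P) (hPb : bounded_map P) :
  [<-> orthogonally_additive P;
       (forall f : 'I_r -> E,
          \sum_(k < r) P (f k) = \sum_(1 <= k < r.+1) P (M_ k f));
       (forall f : 'I_r -> E, (forall i, 0 <= f i) ->
          \sum_(k < r) P (f k) = \sum_(1 <= k < r.+1) P (M_ k f))].
Proof.
case: n hn hP => // n _ /homogeneous_hpoly hP.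
have P0 : P 0 = 0 := hpolyS0 hP.
have oa_val : positively_orthogonally_additive P -> valuation P.
  exact: positively_oa_valuation hY hP hPb.
split=> [/oa_positively_oa/oa_val vP f|].
  by rewrite sum_M sum_lattice_sort// big_map big_enum.
split=> [PM f _|PM]; first exact: PM.
(* The valuation identity carries additivity from disjoint positive pairs to all disjoint pairs. *)
apply: valuation_orthogonally_additive => //; apply: oa_val.
case: r hr PM => [|[|r]]// _.
exact: positively_oa_of_sum_M.
Qed.
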